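(* Let $k$ be a field, $\Gamma$ an abelian group, $P$ a $\Gamma$-graded Poisson $k$-algebra, $\alpha$ a Poisson derivation of $P$, $\delta$ a Poisson $\alpha$-derivation of $P$, and $B=P[t;\alpha,\delta]_{\mathrm p}$ the Poisson polynomial ring. Let $\gamma\in\Gamma$. \begin{enumerate} \item[(1)] $B$ admits a $\Gamma$-grading (as a Poisson algebra) extending that of $P$ with $t\in B_\gamma$ if and only if $(\alpha,\delta)$ is $\gamma$-compatible. \item[(2)] Assume that $(\alpha,\delta)$ is $\gamma$-compatible and that $P$ is Poisson gr-simple. Then $B$ (with the grading with $\deg t=\gamma$) is Poisson gr-simple if and only if $B$ contains no homogeneous Poisson normal element of the form $t^n+\sum_{i<n}b_it^i$ with $n\ge1$ and $b_i\in P$. \item[(3)] If moreover $\operatorname{char}k=0$, then $B$ is Poisson gr-simple if and only if $\delta$ is not $\alpha$-inner. \end{enumerate}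
   Context: Algebras are nonzero, associative, with identity. A Poisson algebra is a commutative $k$-algebra $P$ with a Lie bracket $\{-,-\}$ ($k$-bilinear) that is a derivation in each variable. It is $\Gamma$-graded if $P=\bigoplus_{\tau\in\Gamma}P_\tau$ (as $k$-vector space) with $P_\rho P_\tau\subseteq P_{\rho\tau}$ and $\{P_\rho,P_\tau\}\subseteq P_{\rho\tau}$ for all $\rho,\tau$. A Poisson ideal is an ideal $I$ with $\{P,I\}\subseteq I$; an ideal is graded if generated by homogeneous elements. $P$ is Poisson gr-simple if $0$ and $P$ are its only graded Poisson ideals. An element $f\in P$ is Poisson normal if $\{P,f\}\subseteq fP$ (same definitions for $B$). A Poisson derivation is a ($k$-linear) derivation $\alpha$ of $P$ with $\alpha(\{a,b\})=\{\alpha(a),b\}+\{a,\alpha(b)\}$. A Poisson $\alpha$-derivation is a ($k$-linear) derivation $\delta$ of $P$ with $\delta(\{a,b\})=\{\delta(a),b\}+\{a,\delta(b)\}+\alpha(a)\delta(b)-\delta(a)\alpha(b)$ for $a,b\in P$. For such a pair, $B=P[t;\alpha,\delta]_{\mathrm p}$ denotes the polynomial algebra $P[t]$ with the unique Poisson bracket that extends the bracket of $P$ and satisfies $\{t,a\}=\alpha(a)t+\delta(a)$ for $a\in P$ (existence and uniqueness are known, by Oh). The pair $(\alpha,\delta)$ is $\gamma$-compatible if $\alpha(P_\tau)\subseteq P_\tau$ and $\delta(P_\tau)\subseteq P_{\gamma\tau}$ for all $\tau\in\Gamma$; the grading of $B$ with $\deg t=\gamma$ is then $B_\beta=\bigoplus_{n\ge0}P_{\beta\gamma^{-n}}t^n$.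 For $u\in P$ put $\delta^{\mathrm p}_u(a)=\{u,a\}-u\alpha(a)$; $\delta$ is $\alpha$-inner if $\delta=\delta^{\mathrm p}_u$ for some $u\in P$. *)

(* Defs.v *)
From HB Require Import structures.
From mathcomp Require Import all_boot all_order all_algebra.
From mathcomp Require Import classical_sets.
From mathcomp Require Import ring.

Set Implicit Arguments.
Unset Strict Implicit.
Unset Printing Implicit Defensive.

Import GRing.Theory.

Local Open Scope classical_set_scope.
Local Open Scope ring_scope.

Section PoissonAlgebras.
Context {k : fieldType} {A : comAlgType k}.
Implicit Types (br : A -> A -> A) (alpha delta d : A -> A) (I S : set A).

Definition derivation d : Prop :=
  linear d /\ forall a b, d (a * b) = d a * b + a * d b.

(* [derivation] includes k-linearity, so the first two fields also give the
   k-bilinearity of the bracket. *)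
Record poisson_bracket br : Prop := PoissonBracket {
  poisson_derivationl : forall b, derivation (br^~ b);
  poisson_derivationr : forall a, derivation (br a);
  poisson_alternating : forall a, br a a = 0;
  poisson_jacobi : forall a b c,
    br a (br b c) + br b (br c a) + br c (br a b) = 0 }.

Definition poisson_derivation br alpha : Prop :=
  derivation alpha /\
  forall a b, alpha (br a b) = br (alpha a) b + br a (alpha b).

Definition poisson_skew_derivation br alpha delta : Prop :=
  derivation delta /\
  forall a b, delta (br a b) =
    br (delta a) b + br a (delta b) + alpha a * delta b - delta a * alpha b.

Definition inner_skew_derivation br alpha (u a : A) : A :=
  br u a - u * alpha a.

Definition skew_inner br alpha delta : Prop :=
  exists u, delta =1 inner_skew_derivation br alpha u.

Definition ideal I : Prop :=
  [/\ I 0, forall x y, I x -> I y -> I (x + y) & forall a x, I x -> I (a * x)].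

Definition poisson_ideal br I : Prop :=
  ideal I /\ forall a x, I x -> I (br a x).

Definition poisson_normal br (f : A) : Prop :=
  forall a, exists c, br a f = f * c.

(* The abelian grading group [Gamma] is written additively. *)
Section Gradings.
Context {Gamma : zmodType}.
Implicit Types (G : Gamma -> set A) (gamma : Gamma).

(* [grading_span] and [grading_free] together say that [A] is the direct sum of
   the k-subspaces [G tau]. *)
Record poisson_grading br G : Prop := PoissonGrading {
  grading0 : forall tau, G tau 0;
  grading_lin : forall tau (c : k) x y, G tau x -> G tau y -> G tau (c *: x + y);
  grading_span : forall x, exists (s : seq Gamma) (c : Gamma -> A),
    (forall tau, G tau (c tau)) /\ x = \sum_(tau <- s) c tau;
  grading_free : forall (s : seq Gamma) (c : Gamma -> A), uniq s ->
    (forall tau, G tau (c tau)) -> \sum_(tau <- s) c tau = 0 ->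
    {in s, forall tau, c tau = 0};
  gradingM : forall rho tau x y, G rho x -> G tau y -> G (rho + tau) (x * y);
  grading_br : forall rho tau x y,
    G rho x -> G tau y -> G (rho + tau) (br x y) }.

Definition homogeneous G : set A := [set x | exists tau, G tau x].

(* [smallest ideal S] is the ideal generated by [S]. *)
Definition graded_ideal G I : Prop :=
  exists2 S, S `<=` homogeneous G & I = smallest ideal S.

Definition poisson_gr_simple br G : Prop :=
  forall I, poisson_ideal br I -> graded_ideal G I -> I = [set 0] \/ I = setT.

Definition compatible G gamma alpha delta : Prop :=
  (forall tau a, G tau a -> G tau (alpha a)) /\
  (forall tau a, G tau a -> G (gamma + tau) (delta a)).

End Gradings.
End PoissonAlgebras.

(* The library only makes {poly P} an algebra over P. This copy of {poly P} is
   the k-algebra, with k acting through P. *)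
Definition kpoly (k : fieldType) (P : comAlgType k) : Type := {poly P}.

Section KPolyAlgebra.
Context {k : fieldType} {P : comAlgType k}.

HB.instance Definition _ := GRing.ComNzRing.on (kpoly P).

Definition kpoly_scale (c : k) (p : kpoly P) : kpoly P :=
  (c%:A : P) *: (p : {poly P}).

Fact kpoly_scaleA a b p :
  kpoly_scale a (kpoly_scale b p) = kpoly_scale (a * b) p.
Proof. by rewrite /kpoly_scale scalerA -scalerAl mul1r scalerA. Qed.

Fact kpoly_scale1 : left_id 1 kpoly_scale.
Proof. by move=> p; rewrite /kpoly_scale !scale1r. Qed.

Fact kpoly_scaleDr : right_distributive kpoly_scale +%R.
Proof. by move=> c p q; rewrite /kpoly_scale scalerDr. Qed.

Fact kpoly_scaleDl p : {morph kpoly_scale^~ p : a b / a + b}.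
Proof. by move=> a b; rewrite /kpoly_scale !scalerDl. Qed.

HB.instance Definition _ := GRing.Zmodule_isLmodule.Build k (kpoly P)
  kpoly_scaleA kpoly_scale1 kpoly_scaleDr kpoly_scaleDl.

Fact kpoly_scaleAl (c : k) (p q : kpoly P) : c *: (p * q) = (c *: p) * q.
Proof. exact: (@scalerAl P {poly P}). Qed.

HB.instance Definition _ :=
  GRing.Lmodule_isLalgebra.Build k (kpoly P) kpoly_scaleAl.
HB.instance Definition _ := GRing.Lalgebra_isComAlgebra.Build k (kpoly P).

End KPolyAlgebra.

Section PoissonPolynomials.
Context {k : fieldType} {P : comAlgType k}.
Implicit Types (brP : P -> P -> P) (alpha delta : P -> P).

(* [brB] is the bracket of the Poisson polynomial ring P[t; alpha, delta]_p,
   with t = 'X. *)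
Definition poisson_poly_bracket brP alpha delta
    (brB : kpoly P -> kpoly P -> kpoly P) : Prop :=
  [/\ poisson_bracket brB,
      forall a b : P, brB a%:P b%:P = (brP a b)%:P
    & forall a : P, brB 'X a%:P = (alpha a)%:P * 'X + (delta a)%:P].

(* B_beta is the direct sum over n of P_(beta - n gamma) t^n. *)
Definition poly_grading {Gamma : zmodType} (G : Gamma -> set P) (gamma : Gamma)
    (beta : Gamma) : set (kpoly P) :=
  [set p : {poly P} | forall n : nat, G (beta - gamma *+ n) p`_n].

Definition monic_form (f : kpoly P) : Prop :=
  exists (n : nat) (b : 'I_n -> P),
    (1 <= n)%N /\ f = ('X^n + \sum_(i < n) (b i)%:P * 'X^i : {poly P}).

End PoissonPolynomials.

(* Existence and uniqueness (Oh) of the bracket of P[t; alpha, delta]_p. *)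
Section DerivationTheory.
Context {k : fieldType} {A : comAlgType k}.
Implicit Types d : A -> A.

Lemma derD d : derivation d -> {morph d : x y / x + y}.
Proof. by case=> dl _ x y; rewrite -[x]scale1r dl !scale1r. Qed.

Lemma der0 d : derivation d -> d 0 = 0.
Proof. by move/derD=> dD; apply: (addIr (d 0)); rewrite -dD !add0r. Qed.

Lemma derN d : derivation d -> {morph d : x / - x}.
Proof.
move=> dd x; apply: (addIr (d x)); rewrite -(derD dd) !addNr; exact: der0.
Qed.

Lemma derZ d : derivation d -> forall (c : k), {morph d : x / c *: x}.
Proof. by move=> dd c x; case: (dd) => dl _; rewrite -[c *: x]addr0 dl der0 // !addr0. Qed.

Lemma der1 d : derivation d -> d 1 = 0.
Proof.
move=> [_ dM]; have := dM 1 1; rewrite !mulr1 mul1r => e.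
by apply: (addIr (d 1)); rewrite -e add0r.
Qed.

End DerivationTheory.

Section OreExistence.
Context {k : fieldType} {P : comAlgType k}.
Variables (br : P -> P -> P) (alpha delta : P -> P).
Hypothesis br_poisson : poisson_bracket br.
Hypothesis alpha_der : poisson_derivation br alpha.
Hypothesis delta_der : poisson_skew_derivation br alpha delta.

Implicit Types (f g h : {poly P}) (d : P -> P).

Lemma poly_mono_ind (K : {poly P} -> Prop) :
  (forall f g, K f -> K g -> K (f + g)) ->
  (forall a n, K (a%:P * 'X^n)) -> forall f, K f.
Proof.
move=> KD KM f; rewrite -[f]coefK poly_def.
elim/big_ind: _ => //; first by have := KM 0 0; rewrite mul0r.
by move=> i _; rewrite -mul_polyC; apply: KM.
Qed.

Definition cmap d f := map_poly d f.

Lemma coef_cmap d : derivation d -> forall f i, (cmap d f)`_i = d f`_i.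
Proof. by move=> dd f i; rewrite /cmap coef_map_id0 // der0. Qed.

Lemma cmapD d : derivation d -> {morph cmap d : f g / f + g}.
Proof. by move=> dd f g; apply/polyP=> i; rewrite coefD !coef_cmap // coefD derD. Qed.

Lemma coefM1 (a : P) n i : (a%:P * 'X^n)`_i = if i == n then a else 0.
Proof. by rewrite coefCM coefXn; case: eqP; rewrite (mulr1, mulr0). Qed.

Lemma cmap_mono d : derivation d ->
  forall a n, cmap d (a%:P * 'X^n) = (d a)%:P * 'X^n.
Proof.
move=> dd a n; apply/polyP=> i; rewrite coef_cmap // !coefM1.
by case: eqP => // _; rewrite der0.
Qed.

Lemma cmapC d : derivation d -> forall a, cmap d a%:P = (d a)%:P.
Proof. by move=> dd a; have := cmap_mono dd a 0; rewrite expr0 !mulr1. Qed.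

Lemma monoM (a b : P) i j :
  (a%:P * 'X^i) * (b%:P * 'X^j) = (a * b)%:P * 'X^(i + j).
Proof. by rewrite polyCM exprD; ring. Qed.

Lemma cmapM d : derivation d ->
  forall f g, cmap d (f * g) = cmap d f * g + f * cmap d g.
Proof.
move=> dd; elim/poly_mono_ind=> [f1 f2 e1 e2 g|a i].
  by rewrite mulrDl !cmapD // e1 e2; ring.
elim/poly_mono_ind=> [g1 g2 e1 e2|b j].
  by rewrite mulrDr !cmapD // e1 e2; ring.
by rewrite monoM !cmap_mono // !monoM (dd.2) polyCD; ring.
Qed.

Lemma cmap_deriv d : derivation d -> forall f, cmap d f^`() = (cmap d f)^`().
Proof.
move=> dd f; apply/polyP=> i; rewrite coef_deriv !coef_cmap // coef_deriv.
by elim: {2 4}(i.+1) => [|n e]; rewrite ?mulr0n ?der0 // !mulrSr derD // e.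
Qed.

Definition cbr f g : {poly P} :=
  \poly_(n < size f + size g) \sum_(i < n.+1) br f`_i g`_(n - i).

Let brl b : derivation (br^~ b) := poisson_derivationl br_poisson b.
Let brr a : derivation (br a) := poisson_derivationr br_poisson a.
Let br0x b : br 0 b = 0. Proof. exact: (der0 (brl b)). Qed.
Let brx0 a : br a 0 = 0. Proof. exact: (der0 (brr a)). Qed.

Lemma coef_cbr f g n :
  (cbr f g)`_n = \sum_(i < n.+1) br f`_i g`_(n - i).
Proof.
rewrite coef_poly; case: ltnP => // hn; rewrite big1 // => i _.
case: (ltnP i (size f)) => hi; last by rewrite (nth_default 0 hi) br0x.
rewrite (@nth_default _ 0 g) ?brx0 //.
rewrite leq_subRL; last by rewrite -ltnS.
by apply: leq_trans hn; rewrite leq_add2r ltnW.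
Qed.

Lemma cbrDl f1 f2 g : cbr (f1 + f2) g = cbr f1 g + cbr f2 g.
Proof.
apply/polyP=> n; rewrite coefD !coef_cbr -big_split /=.
by apply: eq_bigr=> i _; rewrite coefD (derD (brl _)).
Qed.

Lemma cbrDr f g1 g2 : cbr f (g1 + g2) = cbr f g1 + cbr f g2.
Proof.
apply/polyP=> n; rewrite coefD !coef_cbr -big_split /=.
by apply: eq_bigr=> i _; rewrite coefD (derD (brr _)).
Qed.

Lemma cbr_mono a i b j :
  cbr (a%:P * 'X^i) (b%:P * 'X^j) = (br a b)%:P * 'X^(i + j).
Proof.
apply/polyP=> n; rewrite coef_cbr coefM1.
have [->|nij] := eqVneq n (i + j)%N.
  have hi : (i < (i + j).+1)%N by rewrite ltnS leq_addr.
  rewrite (bigD1 (Ordinal hi)) //= !coefM1 eqxx addKn eqxx big1 ?addr0 //.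
  by move=> l nl; rewrite !coefM1 -[i in _ == i]/(val (Ordinal hi)) val_eqE (negPf nl) br0x.
rewrite big1 // => l _; rewrite !coefM1; case: eqP => [li|]; last by rewrite br0x.
case: eqP => [lj|]; last by rewrite brx0.
by move: nij; rewrite -li -lj subnKC ?eqxx // -ltnS.
Qed.

Lemma cbrN f g : cbr f g = - cbr g f.
Proof.
elim/poly_mono_ind: f g => [f1 f2 e1 e2 g|a i].
  by rewrite cbrDl cbrDr e1 e2; ring.
elim/poly_mono_ind=> [g1 g2 e1 e2|b j].
  by rewrite cbrDl cbrDr e1 e2; ring.
rewrite !cbr_mono addnC -mulNr -polyCN; congr (_%:P * _).
apply/eqP; rewrite -addr_eq0; apply/eqP.
have := poisson_alternating br_poisson (a + b).
rewrite (derD (brl _)) !(derD (brr _)) !(poisson_alternating br_poisson).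
by rewrite add0r addr0.
Qed.

Lemma cbrff f : cbr f f = 0.
Proof.
elim/poly_mono_ind: f => [f1 f2 e1 e2|a i].
  by rewrite cbrDl !cbrDr e1 e2 (cbrN f2); ring.
by rewrite cbr_mono (poisson_alternating br_poisson) mul0r.
Qed.

Lemma cbrMr f g h : cbr f (g * h) = cbr f g * h + g * cbr f h.
Proof.
elim/poly_mono_ind: f g h => [f1 f2 e1 e2 g h|a i].
  by rewrite !cbrDl e1 e2; ring.
elim/poly_mono_ind=> [g1 g2 e1 e2 h|b j].
  by rewrite mulrDl !cbrDr e1 e2; ring.
elim/poly_mono_ind=> [h1 h2 e1 e2|c l].
  by rewrite mulrDr !cbrDr e1 e2; ring.
by rewrite monoM !cbr_mono (brr a).2 polyCD !polyCM !exprD; ring.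
Qed.

Lemma cbrMl f g h : cbr (f * g) h = cbr f h * g + f * cbr g h.
Proof. by rewrite cbrN cbrMr !(cbrN h); ring. Qed.

Lemma cbr_jacobi f g h :
  cbr f (cbr g h) + cbr g (cbr h f) + cbr h (cbr f g) = 0.
Proof.
elim/poly_mono_ind: f g h => [f1 f2 e1 e2 g h|a i].
  rewrite !(cbrDl, cbrDr); transitivity (0 + 0 : {poly P}); last by rewrite addr0.
  by rewrite -{1}(e1 g h) -(e2 g h); ring.
elim/poly_mono_ind=> [g1 g2 e1 e2 h|b j].
  rewrite !(cbrDl, cbrDr); transitivity (0 + 0 : {poly P}); last by rewrite addr0.
  by rewrite -{1}(e1 h) -(e2 h); ring.
elim/poly_mono_ind=> [h1 h2 e1 e2|c l].
  rewrite !(cbrDl, cbrDr); transitivity (0 + 0 : {poly P}); last by rewrite addr0.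
  by rewrite -{1}e1 -e2; ring.
rewrite !cbr_mono.
transitivity ((br a (br b c) + br b (br c a) + br c (br a b))%:P
  * 'X^(i + (j + l)) : {poly P}); last by rewrite poisson_jacobi // mul0r.
by rewrite !polyCD !exprD; ring.
Qed.

Lemma deriv_cbr f g : (cbr f g)^`() = cbr f^`() g + cbr f g^`().
Proof.
elim/poly_mono_ind: f g => [f1 f2 e1 e2 g|a i].
  by rewrite !(cbrDl, cbrDr, derivD) e1 e2 ?(cbrDl, cbrDr); ring.
elim/poly_mono_ind=> [g1 g2 e1 e2|b j].
  by rewrite !(cbrDl, cbrDr, derivD) e1 e2 ?(cbrDl, cbrDr); ring.
rewrite !deriv_mulC !cbr_mono deriv_mulC !derivXn.
have E (c : P) n m : c%:P * ('X^n *+ m) = (c *+ m)%:P * 'X^n :> {poly P}.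
  by rewrite polyCMn mulrnAr mulrnAl.
have brMl m : br (a *+ m) b = br a b *+ m.
  by elim: m => [|m e]; rewrite ?mulr0n ?br0x // !mulrSr (derD (brl b)) e.
have brMr m : br a (b *+ m) = br a b *+ m.
  by elim: m => [|m e]; rewrite ?mulr0n ?brx0 // !mulrSr (derD (brr a)) e.
rewrite !E !cbr_mono brMl brMr -!E.
case: i j => [|i] [|j] //=.
- by rewrite !mulr0n mulr0 addr0.
- by rewrite !add0n mulr0n mulr0 add0r.
- by rewrite !addn0 mulr0n mulr0 addr0.
by rewrite -mulrDr addSn addnS -mulrnDr addSn addnS.
Qed.

Let da := alpha_der.1.
Let dd := delta_der.1.

Lemma cmapa_cbr f g :
  cmap alpha (cbr f g) = cbr (cmap alpha f) g + cbr f (cmap alpha g).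
Proof.
elim/poly_mono_ind: f g => [f1 f2 e1 e2 g|a i].
  by rewrite !(cbrDl, cmapD da) e1 e2; ring.
elim/poly_mono_ind=> [g1 g2 e1 e2|b j].
  by rewrite !(cbrDr, cmapD da) e1 e2; ring.
by rewrite !(cbr_mono, cmap_mono da) alpha_der.2 polyCD; ring.
Qed.

Lemma cmapd_cbr f g :
  cmap delta (cbr f g) = cbr (cmap delta f) g + cbr f (cmap delta g)
    + cmap alpha f * cmap delta g - cmap delta f * cmap alpha g.
Proof.
elim/poly_mono_ind: f g => [f1 f2 e1 e2 g|a i].
  by rewrite !(cbrDl, cmapD da, cmapD dd) e1 e2; ring.
elim/poly_mono_ind=> [g1 g2 e1 e2|b j].
  by rewrite !(cbrDr, cmapD da, cmapD dd) e1 e2; ring.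
rewrite !(cbr_mono, cmap_mono da, cmap_mono dd) delta_der.2 !monoM.
by rewrite !polyCD polyCN; ring.
Qed.

Definition Dt f : {poly P} := cmap alpha f * 'X + cmap delta f.

(* The bracket in closed form: [cbr] is the bracket of P extended by making 'X
   a Casimir element, and Dt f = alpha(f) t + delta(f) = {t, f}. *)
Definition ore f g : {poly P} := cbr f g + f^`() * Dt g - Dt f * g^`().

Lemma cbrX f : cbr 'X f = 0.
Proof.
rewrite -['X]mul1r -polyC1 -['X]expr1.
elim/poly_mono_ind: f => [f g e1 e2|a i]; first by rewrite cbrDr e1 e2 addr0.
by rewrite cbr_mono (der1 (brl a)) mul0r.
Qed.

Lemma DtD : {morph Dt : f g / f + g}.
Proof. by move=> f g; rewrite /Dt (cmapD da) (cmapD dd); ring. Qed.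
Lemma DtM f g : Dt (f * g) = Dt f * g + f * Dt g.
Proof. by rewrite /Dt (cmapM da) (cmapM dd); ring. Qed.
Lemma deriv_Dt f : (Dt f)^`() = Dt f^`() + cmap alpha f.
Proof.
by rewrite /Dt derivD derivM derivX !cmap_deriv //; ring.
Qed.
Lemma cbrXr f : cbr f 'X = 0. Proof. by rewrite cbrN cbrX oppr0. Qed.

Lemma Dt_cbr f g : Dt (cbr f g) =
  cbr (Dt f) g + cbr f (Dt g) + cmap alpha f * Dt g - Dt f * cmap alpha g.
Proof.
rewrite /Dt cmapa_cbr cmapd_cbr !(cbrDl, cbrDr, cbrMl, cbrMr) cbrX cbrXr.
by ring.
Qed.

Lemma ore_alt f : ore f f = 0.
Proof. by rewrite /ore cbrff; ring. Qed.
Lemma oreDr f g h : ore f (g + h) = ore f g + ore f h.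
Proof. by rewrite /ore cbrDr DtD derivD; ring. Qed.
Lemma oreN f g : ore f g = - ore g f.
Proof. by rewrite /ore cbrN; ring. Qed.
Lemma oreMr f g h : ore f (g * h) = ore f g * h + g * ore f h.
Proof. by rewrite /ore cbrMr DtM derivM; ring. Qed.

Lemma DtN f : Dt (- f) = - Dt f.
Proof. by apply: (addIr (Dt f)); rewrite -DtD !addNr /Dt /cmap !map_poly0 mul0r addr0. Qed.
Lemma cbrNr f g : cbr f (- g) = - cbr f g.
Proof.
apply: (addIr (cbr f g)); rewrite -cbrDr !addNr.
by have := cbrDr f 0 0; rewrite addr0 => e; apply: (addIr (cbr f 0)); rewrite -e add0r.
Qed.

Lemma ore_jacobi f g h :
  ore f (ore g h) + ore g (ore h f) + ore h (ore f g) = 0.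
Proof.
rewrite /ore.
move: Dt DtD DtM DtN deriv_Dt Dt_cbr => D DD DM DN dD Dc.
rewrite !(cbrDr, cbrNr, cbrMr, DD, DN, DM, derivD, derivN, derivM).
rewrite !(deriv_cbr, Dc, dD).
rewrite !(cbrN g f, cbrN h f, cbrN h g, cbrN g f^`(), cbrN h f^`(),
  cbrN h g^`(), cbrN g^`() f, cbrN h^`() f, cbrN h^`() g,
  cbrN g (D f), cbrN h (D f), cbrN h (D g), cbrN (D g) f, cbrN (D h) f,
  cbrN (D h) g, cbrN (D g) f^`(), cbrN (D h) f^`(), cbrN (D h) g^`(),
  cbrN g^`() (D f), cbrN h^`() (D f), cbrN h^`() (D g)).
rewrite !cbrNr.
have -> : cbr h (cbr f g) = cbr g (cbr f h) - cbr f (cbr g h).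
  have := cbr_jacobi f g h; rewrite (cbrN h f) cbrNr => J.
  by rewrite -[LHS]subr0 -J; ring.
ring.
Qed.

Lemma oreZr (c : k) f (g : kpoly P) : ore f (c *: g) = c *: (ore f g : kpoly P).
Proof.
rewrite [c *: g](_ : _ = (c%:A : P)%:P * g :> {poly P}); last by rewrite mul_polyC.
rewrite [RHS](_ : _ = (c%:A : P)%:P * ore f g :> {poly P}); last by rewrite mul_polyC.
rewrite oreMr [ore f _](_ : _ = 0) ?mul0r ?add0r //.
have dA d : derivation d -> d c%:A = 0.
  by move=> hd; rewrite (derZ hd) (der1 hd) scaler0.
have cb0 : cbr f (c%:A)%:P = 0.
  rewrite -[_%:P]mulr1 -(expr0 'X); elim/poly_mono_ind: f => [f1 f2 e1 e2|a i].
    by rewrite cbrDl e1 e2 addr0.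
  by rewrite cbr_mono (dA _ (brr a)) mul0r.
rewrite /ore cb0 derivC mulr0 subr0 add0r.
have -> : Dt (c%:A)%:P = 0; last by rewrite mulr0.
by rewrite /Dt !cmapC // (dA _ da) (dA _ dd) mul0r addr0.
Qed.

Lemma ore_derr f : derivation (ore f : kpoly P -> kpoly P).
Proof.
split=> [c g h|g h]; last exact: oreMr.
by rewrite oreDr oreZr.
Qed.

Lemma ore_derl g : derivation ((fun f => ore f g) : kpoly P -> kpoly P).
Proof.
have [l m] := ore_derr g; split=> [c f h|f h].
  rewrite oreN l (oreN f) (oreN h) opprD.
  by congr (_ - _); exact: (esym (scalerN _ (ore g f : kpoly P))).
by rewrite oreN m opprD -mulNr -mulrN -!oreN.
Qed.

Theorem poisson_poly_bracket_exists :
  exists brB, poisson_poly_bracket br alpha delta brB.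
Proof.
exists ore; split.
- split; [exact: ore_derl|exact: ore_derr|exact: ore_alt|exact: ore_jacobi].
- move=> a b; rewrite /ore !derivC mul0r mulr0 addr0 subr0.
  by have := cbr_mono a 0 b 0; rewrite expr0 !mulr1.
- move=> a; rewrite /ore cbrX derivX derivC mulr0 subr0 mul1r add0r.
  by rewrite /Dt !cmapC.
Qed.

Theorem poisson_poly_bracket_unique brB1 brB2 :
  poisson_poly_bracket br alpha delta brB1 ->
  poisson_poly_bracket br alpha delta brB2 -> forall f g, brB1 f g = brB2 f g.
Proof.
move=> [p1 c1 x1] [p2 c2 x2].
have ext (d1 d2 : kpoly P -> kpoly P) : derivation d1 -> derivation d2 ->
    (forall a : P, d1 a%:P = d2 a%:P) -> d1 'X = d2 'X -> d1 =1 d2.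
  move=> h1 h2 ec ex; elim/poly_mono_ind=> [f g ef eg|a n].
    by rewrite (derD h1 f g) (derD h2 f g) ef eg.
  rewrite h1.2 h2.2 ec; congr (_ * _ + _ * _).
  elim: n => [|n e]; first by rewrite expr0 (der1 h1) (der1 h2).
  by rewrite exprS h1.2 h2.2 ex e.
have alt br' : poisson_bracket br' -> forall f g : kpoly P, br' f g = - br' g f.
  move=> p f g; apply/eqP; rewrite -addr_eq0; apply/eqP.
  have := poisson_alternating p (f + g).
  rewrite (derD (poisson_derivationl p _)) !(derD (poisson_derivationr p _)).
  by rewrite !(poisson_alternating p) add0r addr0.
move=> f g; apply: (ext (brB1^~ g) (brB2^~ g)).
- exact: poisson_derivationl. - exact: poisson_derivationl.
- move=> a; apply: ext; [exact: poisson_derivationr|exact: poisson_derivationr| |].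
    by move=> b; rewrite c1 c2.
  by rewrite (alt _ p1) (alt _ p2) x1 x2.
- apply: ext; [exact: poisson_derivationr|exact: poisson_derivationr| |].
    by move=> b; rewrite x1 x2.
  by rewrite !poisson_alternating.
Qed.
End OreExistence.

(* Main.v *)
Require Import Defs.
From mathcomp Require Import all_boot all_order all_algebra.
From mathcomp Require Import boolp classical_sets.
From mathcomp Require Import ring.

Set Implicit Arguments.
Unset Strict Implicit.
Unset Printing Implicit Defensive.

Import GRing.Theory.

Local Open Scope ring_scope.

(** Write B for the Poisson polynomial ring P[t; alpha, delta] and G for the
    grading of P.

    A grading of B as in (1) contains, for a in G tau, the element
    {t, a} = alpha(a) t + delta(a) in its degree gamma + tau; reading off the
    component of that degree coefficient by coefficient puts alpha(a) in
    degree tau and delta(a) in degree gamma + tau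
    ([compatible_of_grading]).  Conversely, under compatibility every operation
    in the closed formula for the bracket of B respects the degrees of
    [poly_grading] ([poly_grading_br], [poly_grading_poisson]).

    For (2), a homogeneous normal monic f of positive degree generates a graded
    Poisson ideal fB, which is nonzero and proper because multiplication by a
    monic polynomial adds degrees ([not_simple_of_normal]).  Conversely, let I
    be a nonzero proper graded Poisson ideal and n the least degree of its
    nonzero elements.  The coefficients at t^n of the elements of I of degree
    at most n form a nonzero graded Poisson ideal of P, so they fill P; hence I
    contains a polynomial with leading term t^n, and its component of degree
    n gamma keeps that leading term.  Dividing a bracket {b, f}, which lies in
    I, by this monic f leaves a remainder in I of smaller degree, so the
    remainder vanishes and f is normal ([normal_in_proper_ideal]).

    For (3), if delta is inner with witness u, the component of u of degree
    gamma is a witness as well, and t - u is then homogeneous and normal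
    ([homogeneous_normal_of_inner]).  Conversely, if f = t^n + b t^(n-1) + ...
    is normal and a is in P, then {a, f} = f c with c constant for reasons of
    degree; comparing the coefficients of t^n and t^(n-1) gives
    n delta(a) = {a, b} + alpha(a) b, so that u = - b / n works in
    characteristic 0 ([inner_of_normal]). *)

(** * Decompositions into homogeneous components *)

Section Decompositions.
Context {Gamma : zmodType}.

(** The sum is required over every large enough duplicate-free list rather than
    over one list, so that decompositions of two elements can be compared and
    added without adjusting their supports. *)
Definition decomposition {A : zmodType} (G : Gamma -> set A)
    (x : A) (c : Gamma -> A) : Prop :=
  (forall tau, G tau (c tau)) /\
  exists s : seq Gamma, forall s', uniq s' -> {subset s <= s'} ->
    x = \sum_(tau <- s') c tau.

Lemma decompositionD {A : zmodType} (G : Gamma -> set A) x y c d :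
  (forall tau u v, G tau u -> G tau v -> G tau (u + v)) ->
  decomposition G x c -> decomposition G y d ->
  decomposition G (x + y) (fun tau => c tau + d tau).
Proof.
move=> GD [Gc [s sP]] [Gd [r rP]]; split=> [tau|]; first exact: GD.
exists (s ++ r) => s' us' sub; rewrite big_split /=; congr (_ + _).
  by apply: sP => // i si; apply: sub; rewrite mem_cat si.
by apply: rP => // i ri; apply: sub; rewrite mem_cat ri orbT.
Qed.

(** This is the single tool for computing components: multiplication by a
    homogeneous element, bracketing with one, inclusion of constants and
    extraction of a coefficient are all additive maps that shift degrees. *)
Lemma decomposition_graded_map {A A' : zmodType} (G : Gamma -> set A)
    (G' : Gamma -> set A') (f : A -> A') sigma x c :
  {morph f : u v / u + v} ->
  (forall tau u, G tau u -> G' (tau + sigma) (f u)) ->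
  decomposition G x c ->
  decomposition G' (f x) (fun tau => f (c (tau - sigma))).
Proof.
move=> fD fG [Gc [s sP]]; split=> [tau|].
  by have := fG _ _ (Gc (tau - sigma)); rewrite subrK.
have f0 : f 0 = 0 by apply: (addIr (f 0)); rewrite -fD !add0r.
exists [seq tau + sigma | tau <- s] => s' us' sub.
rewrite (sP [seq tau - sigma | tau <- s']).
- by rewrite (big_morph f fD f0) big_map.
- by rewrite map_inj_uniq //; apply: addIr.
- move=> tau stau; apply/mapP; exists (tau + sigma); last by rewrite addrK.
  by apply: sub; apply: map_f.
Qed.

Lemma decomposition_homogeneous {A : zmodType} (G : Gamma -> set A) tau x :
  (forall rho, G rho 0) -> G tau x ->
  decomposition G x (fun rho => if rho == tau then x else 0).
Proof.
move=> G0 Gx; split=> [rho|]; first by case: eqP => [->|].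
exists [:: tau] => s us sub.
rewrite (bigD1_seq tau) ?sub ?mem_head //= eqxx big1 ?addr0 // => rho.
by move/negPf->.
Qed.

End Decompositions.

(** * Components and ideals in a graded Poisson algebra *)

Section GradedAlgebra.
Context {k : fieldType} {Gamma : zmodType} {A : comAlgType k}.
Variables (br : A -> A -> A) (G : Gamma -> set A).
Hypothesis HG : poisson_grading br G.

Lemma gradingD tau x y : G tau x -> G tau y -> G tau (x + y).
Proof. by move=> Gx Gy; rewrite -[x]scale1r; apply: (grading_lin HG). Qed.

Lemma gradingN tau x : G tau x -> G tau (- x).
Proof.
move=> Gx; rewrite -[- x]addr0 -scaleN1r.
by apply: (grading_lin HG) => //; apply: (grading0 HG).
Qed.

Lemma gradingB tau x y : G tau x -> G tau y -> G tau (x - y).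
Proof. by move=> Gx Gy; apply: gradingD => //; apply: gradingN. Qed.

Lemma grading_sum tau (I : Type) (r : seq I) (Q : pred I) (F : I -> A) :
  (forall i, Q i -> G tau (F i)) -> G tau (\sum_(i <- r | Q i) F i).
Proof.
move=> GF; elim/big_ind: _ => //; first exact: (grading0 HG).
by move=> x y; apply: gradingD.
Qed.

Lemma grading_mulrn tau x n : G tau x -> G tau (x *+ n).
Proof.
by move=> Gx; elim: n => [|n IH]; rewrite ?mulr0n ?mulrS;
  [apply: (grading0 HG)|apply: gradingD].
Qed.

Lemma decomposition_exists x : exists c, decomposition G x c.
Proof.
have [s [c [Gc ->]]] := grading_span HG x.
(* The list given by the grading may repeat a degree: the component then
   occurs with its multiplicity. *)
exists (fun tau => c tau *+ count_mem tau s); split=> [tau|].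
  exact: grading_mulrn.
exists s; elim: s => [|a s IH] s' us' sub.
  by rewrite big_nil big1 // => i _; rewrite mulr0n.
rewrite big_cons (IH s' us'); last first.
  by move=> i si; apply: sub; rewrite inE si orbT.
under [RHS]eq_bigr => i _ do rewrite /= mulrnDr.
rewrite big_split /=; congr (_ + _).
rewrite (bigD1_seq a) ?sub ?mem_head //= eqxx mulr1n big1 ?addr0 // => i.
by rewrite eq_sym => /negPf->.
Qed.

Lemma decomposition_unique x c d :
  decomposition G x c -> decomposition G x d -> c = d.
Proof.
move=> [Gc [s sP]] [Gd [r rP]]; apply/funext => tau.
pose s' := undup (tau :: s ++ r).
have us' : uniq s' by apply: undup_uniq.
apply/eqP; rewrite -subr_eq0; apply/eqP.
apply: (grading_free HG (s := s') (c := fun tau => c tau - d tau)) => //.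
- by move=> rho; apply: gradingB.
- rewrite sumrB -sP -?rP ?subrr // => i; rewrite mem_undup inE mem_cat.
    by move=> ->; rewrite !orbT.
  by move=> ->; rewrite orbT.
- by rewrite mem_undup mem_head.
Qed.

Definition component (x : A) : Gamma -> A :=
  xget (fun=> 0) [set c | decomposition G x c].

Lemma componentP x : decomposition G x (component x).
Proof. by have [c cP] := decomposition_exists x; apply: (xgetPex (fun=> 0)); exists c. Qed.

Lemma component_eq x c : decomposition G x c -> component x = c.
Proof. by apply: decomposition_unique; apply: componentP. Qed.

Lemma component_in x tau : G tau (component x tau).
Proof. exact: (componentP x).1. Qed.

Lemma sum_components x :
  exists s : seq Gamma, x = \sum_(tau <- s) component x tau.
Proof.
have [_ [s sP]] := componentP x; exists (undup s); apply: sP.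
  exact: undup_uniq.
by move=> tau; rewrite mem_undup.
Qed.

Lemma componentD x y tau :
  component (x + y) tau = component x tau + component y tau.
Proof.
by rewrite (component_eq (decompositionD gradingD (componentP x) (componentP y))).
Qed.

Lemma component_homogeneous x tau rho :
  G tau x -> component x rho = if rho == tau then x else 0.
Proof.
by move=> Gx; rewrite (component_eq (decomposition_homogeneous (grading0 HG) Gx)).
Qed.

Lemma component_id x tau : G tau x -> component x tau = x.
Proof. by move=> Gx; rewrite (component_homogeneous _ Gx) eqxx. Qed.

Lemma component0 tau : component 0 tau = 0.
Proof. exact: component_id (grading0 HG tau). Qed.

(** The degree 0 component e of 1 satisfies x e = x for every homogeneous x,
    since x e is the component of x 1 in the degree of x; summing over the
    components of 1 gives e = 1. *)
Lemma grading1 : G 0 1.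
Proof.
suff <- : component 1 0 = 1 by apply: component_in.
have unit x tau : G tau x -> x * component 1 0 = x.
  move=> Gx; have mD : {morph *%R x : u v / u + v} by move=> u v; rewrite mulrDr.
  have mG rho u : G rho u -> G (rho + tau) (x * u).
    by move=> Gu; rewrite addrC; apply: (gradingM HG).
  have := component_eq (decomposition_graded_map mD mG (componentP 1)).
  by move/(congr1 (@^~ tau)); rewrite subrr mulr1 component_id.
have [s e] := sum_components 1.
rewrite -[LHS]mul1r {1 3}e mulr_suml; apply: eq_bigr => tau _.
by apply: unit; apply: component_in.
Qed.

Section Ideals.
Local Open Scope classical_set_scope.
Implicit Types I S : set A.

Lemma smallest_ideal S : ideal (smallest ideal S).
Proof.
split.
- by move=> M [[M0 _ _] _].
- by move=> x y Sx Sy M [iM SM]; case: (iM) => _ MD _; apply: MD; [apply: Sx|apply: Sy].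
- by move=> a x Sx M [iM SM]; case: (iM) => _ _ MM; apply: MM; apply: Sx.
Qed.

Lemma ideal_sum I (J : Type) (r : seq J) (F : J -> A) :
  ideal I -> (forall i, I (F i)) -> I (\sum_(i <- r) F i).
Proof. by case=> I0 ID _ IF; elim/big_ind: _. Qed.

Lemma ideal_setT I : ideal I -> I 1 -> I = setT.
Proof.
by case=> _ _ IM I1; apply/seteqP; split=> // x _; rewrite -[x]mulr1; apply: IM.
Qed.

(** The elements all of whose components lie in I form an ideal, and this ideal
    contains the homogeneous generators of I. *)
Lemma graded_ideal_component I x tau :
  graded_ideal G I -> I x -> I (component x tau).
Proof.
move=> [S Shom ->] Ix; have idl := smallest_ideal S.
suff : [set y | forall rho, smallest ideal S (component y rho)] x by apply.
apply: Ix; split; last first.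
  move=> y Sy rho; have [sigma Gy] := Shom _ Sy.
  rewrite (component_homogeneous _ Gy); case: eqP => _; last by case: idl.
  by move=> M [_]; apply.
case: (idl) => I0 ID IM; split.
- by move=> rho; rewrite component0.
- by move=> u v Iu Iv rho; rewrite componentD; apply: ID.
move=> a u Iu rho; have [s ->] := sum_components a.
rewrite mulr_suml (big_morph (component^~ rho) (id1 := 0) (op1 := +%R)).
- apply: (ideal_sum (I := smallest ideal S)) => // sigma.
  have mD : {morph *%R (component a sigma) : v w / v + w}.
    by move=> v w; rewrite mulrDr.
  have mG nu v : G nu v -> G (nu + sigma) (component a sigma * v).
    by move=> Gv; rewrite addrC; apply: (gradingM HG) => //; apply: component_in.
  rewrite (component_eq (decomposition_graded_map mD mG (componentP u))).
  exact: IM.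
- by move=> v w; rewrite componentD.
- exact: component0.
Qed.

Lemma graded_idealP I : ideal I ->
  (forall x tau, I x -> I (component x tau)) -> graded_ideal G I.
Proof.
move=> idl Icomp; exists (I `&` homogeneous G); first by move=> x [].
apply/seteqP; split=> [x Ix M [[M0 MD MM] sub]|x]; last first.
  by apply; split=> // y [].
have [s ->] := sum_components x; apply: ideal_sum => // tau.
by apply: sub; split; [apply: Icomp|exists tau; apply: component_in].
Qed.

(** Normality is what makes fA a Poisson ideal: {a, f c} = {a, f} c + f {a, c},
    and {a, f} is a multiple of f. *)
Lemma normal_graded_poisson_ideal f :
  poisson_bracket br -> homogeneous G f -> poisson_normal br f ->
  let I := [set x | exists c, x = f * c] in
  poisson_ideal br I /\ graded_ideal G I.
Proof.
move=> Hbr Gf nf I.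
have idl : ideal I.
  split=> [|x y [c ->] [d ->]|a x [c ->]]; first by exists 0; rewrite mulr0.
    by exists (c + d); rewrite mulrDr.
  by exists (a * c); rewrite mulrCA.
split.
  split=> // a x [c ->]; have [d e] := nf a.
  exists (d * c + br a c).
  by rewrite (poisson_derivationr Hbr a).2 e mulrDr mulrA.
exists [set f] => [x ->//|]; apply/seteqP; split=> [x [c ->] M [[_ _ MM] sub]|x].
  by rewrite mulrC; apply: MM; apply: sub.
by apply; split=> // y ->; exists 1; rewrite mulr1.
Qed.

End Ideals.
End GradedAlgebra.

(** * The bracket of the Poisson polynomial ring *)

Lemma poisson_bracketC {k : fieldType} {A : comAlgType k} (br : A -> A -> A)
  (a b : A) : poisson_bracket br -> br a b = - br b a.
Proof.
move=> Hbr; apply/eqP; rewrite -addr_eq0; apply/eqP.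
have := poisson_alternating Hbr (a + b).
rewrite (derD (poisson_derivationl Hbr _)) !(derD (poisson_derivationr Hbr _)).
by rewrite !(poisson_alternating Hbr) add0r addr0.
Qed.

Section PolynomialBracket.
Context {k : fieldType} {P : comAlgType k}.
Variables (br : P -> P -> P) (alpha delta : P -> P).
Variable brB : kpoly P -> kpoly P -> kpoly P.
Hypothesis Hbr : poisson_bracket br.
Hypothesis Halpha : poisson_derivation br alpha.
Hypothesis Hdelta : poisson_skew_derivation br alpha delta.
Hypothesis HB : poisson_poly_bracket br alpha delta brB.
Implicit Types (f g : {poly P}) (a b u : P).

(** The closed formula [ore] for the bracket makes coefficients of brackets
    computable, which the characterisation by generators does not. *)
Lemma brB_ore f g : brB f g = ore br alpha delta f g.
Proof.
apply: (poisson_poly_bracket_unique HB); split.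
- split; [exact: ore_derl|exact: ore_derr|exact: ore_alt|exact: ore_jacobi].
- move=> a b; rewrite /ore !derivC mul0r mulr0 addr0 subr0.
  by have := cbr_mono Hbr a 0 b 0; rewrite expr0 !mulr1.
- move=> a; rewrite /ore (cbrX Hbr) derivX derivC mulr0 subr0 mul1r add0r.
  by rewrite /Dt (cmapC Halpha.1) (cmapC Hdelta.1).
Qed.

Lemma coef_brBC a f n :
  (brB a%:P f)`_n = br a f`_n - alpha a * f`_n *+ n - delta a * f`_n.+1 *+ n.+1.
Proof.
rewrite brB_ore /ore derivC mul0r addr0 /Dt (cmapC Halpha.1) (cmapC Hdelta.1).
rewrite coefB mulrDl -mulrA coefD !coefCM coefXM !coef_deriv opprD addrA.
congr (_ - _ - _); last by rewrite mulrnAr.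
  rewrite (coef_cbr Hbr) big_ord_recl coefC /= subn0 big1 ?addr0 // => i _.
  by rewrite coefC /= (der0 (poisson_derivationl Hbr _)).
by case: n => [|n] /=; rewrite ?mulr0 ?mulr0n // mulrnAr.
Qed.

Lemma monic_formP f : monic_form f <-> f \is monic /\ (1 < size f)%N.
Proof.
split=> [[n [b [n1 ->]]]|[fm sf]].
  have sz : (size (\sum_(i < n) (b i)%:P * 'X^i : {poly P})%R < size ('X^n : {poly P}))%N.
    rewrite size_polyXn ltnS; apply: (leq_trans (size_sum _ _ _)).
    apply/bigmax_leqP => i _; apply: (leq_trans (size_polyMleq _ _)).
    rewrite size_polyXn addnS /=; apply: leq_trans (ltn_ord i).
    by rewrite -add1n leq_add2r size_polyC leq_b1.
  by rewrite monicE lead_coefDl // lead_coefXn size_polyDl // size_polyXn.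
have [n sfE] : exists n, size f = n.+2 by case: (size f) sf => [|[|n]] // _; exists n.
exists n.+1, (fun i => f`_i); split=> //.
rewrite -[LHS]coefK poly_def sfE big_ord_recr /= addrC; congr (_ + _).
  by have /monicP := fm; rewrite /lead_coef sfE => ->; rewrite scale1r.
by apply: eq_bigr => i _; rewrite mul_polyC.
Qed.

(** Inserting delta(a) = {u, a} - u alpha(a) in {t, a} = alpha(a) t + delta(a)
    gives {a, t - u} = - alpha(a) (t - u) and {t, t - u} = - alpha(u) (t - u),
    and multiples of t - u propagate to products by the Leibniz rule. *)
Lemma normal_of_inner u : delta =1 inner_skew_derivation br alpha u ->
  poisson_normal brB ('X - u%:P : {poly P}).
Proof.
move=> dE; have [PB HBC HBX] := HB.
have dr f := poisson_derivationr PB f.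
have dl f := poisson_derivationl PB f.
have br_sub h : brB h ('X - u%:P : {poly P}) = (brB h 'X : {poly P}) - brB h u%:P.
  by rewrite (derD (dr h)) (derN (dr h)).
pose K (h : {poly P}) :=
  exists c : {poly P}, brB h ('X - u%:P : {poly P}) = ('X - u%:P) * c.
have KC a : K a%:P.
  exists (- (alpha a)%:P).
  rewrite br_sub (poisson_bracketC _ _ PB) HBX HBC dE /inner_skew_derivation.
  by rewrite (poisson_bracketC a u Hbr) polyCB polyCM polyCN; ring.
have KX : K 'X.
  exists (- (alpha u)%:P).
  rewrite br_sub (poisson_alternating PB) HBX dE /inner_skew_derivation.
  by rewrite (poisson_alternating Hbr) polyCB polyCM polyC0; ring.
have KM f g : K f -> K g -> K (f * g).
  move=> [c ec] [d ed]; exists (c * g + f * d).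
  have -> : brB (f * g) ('X - u%:P : {poly P}) =
      brB f ('X - u%:P : {poly P}) * g + f * brB g ('X - u%:P : {poly P}) :> {poly P}.
    exact: (dl _).2.
  by rewrite ec ed; ring.
suff : forall h, K h by [].
elim/(@poly_mono_ind k P) => [f g [c ec] [d ed]|a n].
  by exists (c + d); rewrite (derD (dl _)) ec ed mulrDr.
apply: (KM) => //; elim: n => [|n IH]; last by rewrite exprS; apply: KM.
by have := KC 1; rewrite polyC1.
Qed.

(** With f = t^n + b t^(n-1) + ... and {a, f} = f c, the coefficient of t^n gives
    c = - n alpha(a), and that of t^(n-1) then gives
    n delta(a) = {a, b} + alpha(a) b. *)
Lemma inner_of_normal f : [pchar k] =i pred0 ->
  poisson_normal brB f -> monic_form f -> skew_inner br alpha delta.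
Proof.
move=> chk nf /monic_formP [fm sf].
(* The degree n of the informal computation is n.+1 below. *)
have [n sfE] : exists n, size f = n.+2 by case: (size f) sf => [|[|n]] // _; exists n.
have f1 : f`_n.+1 = 1 by have /monicP := fm; rewrite /lead_coef sfE.
have f0 : f`_n.+2 = 0 by rewrite nth_default ?sfE.
pose N : k := n.+1%:R.
have N0 : N != 0 by rewrite (pcharf0P k).1.
have invN (x : P) : N^-1 *: (x *+ n.+1) = x.
  by rewrite -scaler_nat scalerA mulVf ?scale1r.
exists (- (N^-1 *: f`_n)) => a.
have [c ec] : exists c : {poly P}, brB a%:P f = f * c := nf a%:P.
have lc i : (n.+1 < i)%N -> (brB a%:P f)`_i = 0.
  move=> ni; rewrite coef_brBC !nth_default ?sfE // ?(leq_trans ni) //.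
  by rewrite (der0 (poisson_derivationr Hbr a)) !mulr0 !mul0rn !subr0.
(* Bracketing with a constant does not raise the degree, and f is monic, so c
   is constant. *)
have sc : (size c <= 1)%N.
  have [->|c0] := eqVneq c 0; first by rewrite size_poly0.
  have : (size (f * c)%R <= n.+2)%N by rewrite -ec; apply/leq_sizeP => i; apply: lc.
  by rewrite size_monicM // sfE !addSn /= ltnS -addn1 leq_add2l.
rewrite (size1_polyC sc) in ec; set c0 := c`_0 in ec.
have top : c0 = - (alpha a *+ n.+1).
  have := congr1 (fun p : {poly P} => p`_n.+1) ec.
  rewrite /= coef_brBC f0 f1 (der1 (poisson_derivationr Hbr a)) mulr0 mul0rn.
  by rewrite coefMC f1 mulr1 mul1r subr0 sub0r.
have next : delta a *+ n.+1 = br a f`_n + alpha a * f`_n.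
  have := congr1 (fun p : {poly P} => p`_n) ec.
  rewrite /= coef_brBC f1 mulr1 coefMC top => e.
  rewrite -[LHS]opprK -[- (_ *+ _)](addKr (br a f`_n - alpha a * f`_n *+ n)) e.
  by rewrite mulrS; ring.
rewrite -[LHS]invN next /inner_skew_derivation.
rewrite (derN (poisson_derivationl Hbr a)) (derZ (poisson_derivationl Hbr a)).
rewrite (poisson_bracketC f`_n a Hbr).
by rewrite scalerN opprK scalerDr mulNr opprK -scalerAl [f`_n * _]mulrC.
Qed.

End PolynomialBracket.

(** * The grading of the polynomial ring *)

Section GradedPolynomials.
Context {k : fieldType} {Gamma : zmodType} {P : comAlgType k}.
Variables (br : P -> P -> P) (G : Gamma -> set P) (alpha delta : P -> P).
Variables (brB : kpoly P -> kpoly P -> kpoly P) (gamma : Gamma).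
Hypothesis Hbr : poisson_bracket br.
Hypothesis HG : poisson_grading br G.
Hypothesis Halpha : poisson_derivation br alpha.
Hypothesis Hdelta : poisson_skew_derivation br alpha delta.
Hypothesis HB : poisson_poly_bracket br alpha delta brB.
Implicit Types (f g : {poly P}) (a b u : P) (tau rho beta : Gamma).

Local Notation BG := (poly_grading G gamma).

(** {t, a} = alpha(a) t + delta(a) equals its own component of degree
    gamma + tau, which is alpha(a)_tau t + delta(a)_(gamma + tau). *)
Lemma compatible_of_grading (H : Gamma -> set (kpoly P)) :
  poisson_grading brB H -> (forall tau a, H tau a%:P <-> G tau a) ->
  H gamma 'X -> compatible G gamma alpha delta.
Proof.
move=> HH HGE HX.
suff key tau a : G tau a -> G tau (alpha a) /\ G (gamma + tau) (delta a).
  by split=> tau a /key [].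
move=> Ga; have [_ _ brXE] := HB.
have compC b rho : component H b%:P rho = (component G b rho)%:P.
  have mD : {morph (fun c : P => c%:P : kpoly P) : x y / x + y}.
    by move=> x y; apply: polyCD.
  have mG nu c : G nu c -> H (nu + 0) (c%:P : kpoly P).
    by rewrite addr0 => Gc; apply/HGE.
  rewrite (component_eq HH (decomposition_graded_map mD mG (componentP HG b))).
  by rewrite subr0.
have compX b rho :
    component H (b%:P * 'X : {poly P}) (gamma + rho) = (component G b rho)%:P * 'X.
  have mD : {morph (fun c : P => c%:P * 'X : kpoly P) : x y / x + y}.
    by move=> x y; rewrite polyCD mulrDl.
  have mG nu c : G nu c -> H (nu + gamma) (c%:P * 'X : {poly P}).
    by move=> Gc; apply: (gradingM HH) => //; apply/HGE.
  rewrite (component_eq HH (decomposition_graded_map mD mG (componentP HG b))).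
  by rewrite [gamma + rho]addrC addrK.
have := component_id HH (grading_br HH HX ((HGE _ _).2 Ga)).
rewrite brXE (componentD HH) compX compC => e.
have e1 := congr1 (fun p : {poly P} => p`_1) e.
have e0 := congr1 (fun p : {poly P} => p`_0) e.
move: e1 e0; rewrite /= !coefD !coefCM !coefC !coefX /= !mulr1 !mulr0 !addr0 !add0r.
by move=> <- <-; split; apply: component_in HG _ _.
Qed.

Lemma poly_gradingM rho tau f g : BG rho f -> BG tau g -> BG (rho + tau) (f * g).
Proof.
move=> Gf Gg n; rewrite coefM; apply: (grading_sum HG) => i _.
have -> : rho + tau - gamma *+ n =
    (rho - gamma *+ i) + (tau - gamma *+ (n - i)).
  by rewrite addrACA -opprD -mulrnDr subnKC // -ltnS.
exact: (gradingM HG).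
Qed.

Lemma poly_grading_deriv beta f : BG beta f -> BG (beta - gamma) f^`().
Proof.
move=> Gf n; rewrite coef_deriv; apply: (grading_mulrn HG).
by have := Gf n.+1; rewrite mulrS opprD addrA.
Qed.

(** The coefficient 1 of t has to lie in degree gamma - gamma = 0, which is
    [grading1]. *)
Lemma poly_gradingX : BG gamma 'X.
Proof.
move=> n; rewrite coefX; case: eqP => [->|_]; last exact: (grading0 HG).
by rewrite mulr1n subrr; apply: (grading1 HG).
Qed.

Lemma poly_gradingC tau a : BG tau a%:P <-> G tau a.
Proof.
split=> [/(_ 0)|Ga n]; rewrite coefC; first by rewrite mulr0n subr0.
by case: eqP => [->|_]; [rewrite mulr0n subr0|apply: (grading0 HG)].
Qed.

Lemma poly_gradingB tau f g : BG tau f -> BG tau g -> BG tau (f - g).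
Proof. by move=> Gf Gg n; rewrite coefB; apply: (gradingB HG). Qed.

Lemma poly_gradingD tau f g : BG tau f -> BG tau g -> BG tau (f + g).
Proof. by move=> Gf Gg n; rewrite coefD; apply: (gradingD HG). Qed.

Lemma poly_decomposition_exists f : exists c, decomposition BG (f : kpoly P) c.
Proof.
elim/(@poly_mono_ind k P): f => [f g [c fP] [d gP]|a n].
  by eexists; apply: (decompositionD _ fP gP) => tau u v; apply: poly_gradingD.
have mD : {morph (fun b : P => b%:P * 'X^n : kpoly P) : x y / x + y}.
  by move=> x y; rewrite polyCD mulrDl.
have mG tau b : G tau b -> BG (tau + gamma *+ n) (b%:P * 'X^n).
  move=> Gb i; rewrite coefCM coefXn; case: eqP => [->|_].
    by rewrite addrK mulr1.
  by rewrite mulr0; apply: (grading0 HG).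
by eexists; apply: (decomposition_graded_map mD mG (componentP HG a)).
Qed.

Section Compatible.
Hypothesis Hcomp : compatible G gamma alpha delta.

(** [Dt f] is {t, f}: bracketing with t raises the degree by that of t. *)
Lemma poly_grading_Dt beta f : BG beta f -> BG (beta + gamma) (Dt alpha delta f).
Proof.
move=> Gf; apply: poly_gradingD.
  apply: poly_gradingM; last exact: poly_gradingX.
  by move=> n; rewrite (coef_cmap Halpha.1); apply: Hcomp.1.
move=> n; rewrite (coef_cmap Hdelta.1) [beta + gamma]addrC -addrA.
exact: Hcomp.2.
Qed.

(** In {f, g} = cbr f g + f' {t, g} - {t, f} g' the shift by gamma in {t, -}
    cancels the shift by - gamma of the derivative. *)
Lemma poly_grading_br rho tau f g :
  BG rho f -> BG tau g -> BG (rho + tau) (brB f g).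
Proof.
move=> Gf Gg; rewrite (brB_ore Hbr Halpha Hdelta HB).
apply: poly_gradingB; first apply: poly_gradingD.
- move=> n; rewrite (coef_cbr Hbr); apply: (grading_sum HG) => i _.
  have -> : rho + tau - gamma *+ n =
      (rho - gamma *+ i) + (tau - gamma *+ (n - i)).
    by rewrite addrACA -opprD -mulrnDr subnKC // -ltnS.
  exact: (grading_br HG).
- have -> : rho + tau = (rho - gamma) + (tau + gamma).
    by rewrite [tau + gamma]addrC addrA subrK.
  by apply: poly_gradingM; [apply: poly_grading_deriv|apply: poly_grading_Dt].
- have -> : rho + tau = (rho + gamma) + (tau - gamma).
    by rewrite [tau - gamma]addrC addrA addrK.
  by apply: poly_gradingM; [apply: poly_grading_Dt|apply: poly_grading_deriv].
Qed.

Lemma poly_grading_poisson : poisson_grading brB BG.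
Proof.
split.
- by move=> tau n; rewrite coef0; apply: (grading0 HG).
- move=> tau c f g Gf Gg n.
  have -> : (c *: f + g : {poly P})`_n = c *: (f : {poly P})`_n + (g : {poly P})`_n.
    by rewrite coefD; congr (_ + _); rewrite coefZ -scalerAl mul1r.
  exact: (grading_lin HG).
- move=> f; have [c [Gc [s sP]]] := poly_decomposition_exists f.
  exists (undup s), c; split=> //; apply: sP; first exact: undup_uniq.
  by move=> tau; rewrite mem_undup.
- move=> s c us Gc c0 tau stau; apply/polyP => n; rewrite coef0.
  pose c' rho := (c (rho + gamma *+ n) : {poly P})`_n.
  pose s' := [seq tau - gamma *+ n | tau <- s].
  have c'0 : {in s', forall rho, c' rho = 0}.
    apply: (grading_free HG).
    - by rewrite map_inj_uniq //; apply: addIr.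
    - by move=> rho; have := Gc (rho + gamma *+ n) n; rewrite addrK.
    have := congr1 (fun p : {poly P} => p`_n) c0; rewrite coef0 => e.
    rewrite big_map -[RHS]e /= coef_sum.
    by apply: eq_bigr => rho _; rewrite /c' subrK.
  by have := c'0 _ (map_f _ stau); rewrite /c' subrK.
- exact: poly_gradingM.
- exact: poly_grading_br.
Qed.

Let HBG := poly_grading_poisson.

(** Coefficient extraction at t^n is additive and lowers degrees by n gamma. *)
Lemma component_coef f n tau :
  (component BG (f : kpoly P) tau : {poly P})`_n
  = component G f`_n (tau - gamma *+ n).
Proof.
have mD : {morph (fun g : kpoly P => (g : {poly P})`_n) : x y / x + y}.
  by move=> x y; rewrite coefD.
have mG rho g : BG rho g -> G (rho - gamma *+ n) g`_n by apply.
rewrite (component_eq HG (decomposition_graded_map mD mG (componentP HBG f))).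
by rewrite addrK.
Qed.

Lemma not_simple_of_normal (f : kpoly P) :
  homogeneous BG f -> poisson_normal brB f -> monic_form f ->
  ~ poisson_gr_simple brB BG.
Proof.
move=> hf nf /monic_formP [fm sf] sB; have [PB _ _] := HB.
have [pI gI] := normal_graded_poisson_ideal PB hf nf.
case: (sB _ pI gI) => e.
  have : [set 0]%classic f by rewrite -e; exists 1; rewrite mulr1.
  by move=> f0; rewrite f0 size_poly0 in sf.
have : [set: kpoly P]%classic 1 by [].
rewrite -e => -[c e1].
have : size (f * c : {poly P}) = 1 by rewrite -e1 size_poly1.
have [c0|c0] := eqVneq (c : {poly P}) 0; first by rewrite c0 mulr0 size_poly0.
rewrite size_monicM //; move: sf; rewrite -size_poly_gt0 in c0.
by case: (size f) (size (c : {poly P})) c0 => [|[|m]] [|l] //; rewrite addnS.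
Qed.

(** * Elements of minimal degree in a graded Poisson ideal *)

Section MinimalDegree.
Local Open Scope classical_set_scope.
Variable I : set (kpoly P).
Hypothesis pI : poisson_ideal brB I.
Hypothesis gI : graded_ideal BG I.

(** Bounding the degree instead of fixing it lets 0 belong to the set. *)
Definition leading_coefs (n : nat) : set P :=
  [set a | exists f : {poly P}, [/\ I f, (size f <= n.+1)%N & f`_n = a]].

Lemma leading_coefs_ideal n : ideal (leading_coefs n).
Proof.
have [[I0 ID IM] _] := pI; split.
- by exists 0; rewrite size_poly0 coef0.
- move=> _ _ [f [If sf <-]] [g [Ig sg <-]]; exists (f + g); split.
  + exact: ID.
  + by apply: leq_trans (size_polyD _ _) _; rewrite geq_max sf.
  + by rewrite coefD.
- move=> a _ [f [If sf <-]]; exists (a%:P * f); split.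
  + exact: IM.
  + by rewrite mul_polyC; apply: leq_trans (size_scale_leq _ _) sf.
  + by rewrite coefCM.
Qed.

(** The coefficient of {a, f} at t^n is {a, f_n} - n alpha(a) f_n; the second
    term is undone by adding the multiple n alpha(a) f of f. *)
Lemma leading_coefs_poisson n : poisson_ideal br (leading_coefs n).
Proof.
split=> [|a _ [f [If sf <-]]]; first exact: leading_coefs_ideal.
have [[I0 ID IM] IB] := pI.
exists (brB a%:P f + (alpha a *+ n)%:P * f); split.
- by apply: ID; [apply: IB|apply: IM].
- apply/leq_sizeP => i ni; rewrite coefD (coef_brBC Hbr Halpha Hdelta HB) coefCM.
  rewrite !(nth_default 0 (leq_trans sf _)) //; last exact: leqW.
  by rewrite (der0 (poisson_derivationr Hbr a)) !mulr0 !mul0rn !subr0 addr0.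
- rewrite coefD (coef_brBC Hbr Halpha Hdelta HB) coefCM (nth_default 0 sf).
  by rewrite mulr0 mul0rn subr0 mulrnAl subrK.
Qed.

Lemma leading_coefs_graded n : graded_ideal G (leading_coefs n).
Proof.
apply: (graded_idealP HG (leading_coefs_ideal n)) => _ tau [f [If sf <-]].
exists (component BG (f : kpoly P) (tau + gamma *+ n)); split.
- exact: (graded_ideal_component HBG _ gI If).
- apply/leq_sizeP => i ni; rewrite component_coef nth_default ?(leq_trans sf) //.
  exact: (component0 HG).
- by rewrite component_coef addrK.
Qed.

(** The remainder of {h, f} on division by the monic f stays in I and has
    smaller degree than f. *)
Lemma normal_of_minimal_degree f : I f -> f \is monic ->
  (forall g, I g -> (size g < size f)%N -> g = 0) -> poisson_normal brB f.
Proof.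
move=> If fm fmin h; have [[I0 ID IM] IB] := pI.
pose g : {poly P} := brB h f.
have gE := Pdiv.RingMonic.rdivp_eq fm g.
exists (Pdiv.Ring.rdivp g f); rewrite -[brB h f]/g {1}gE.
rewrite (fmin (Pdiv.Ring.rmodp g f)) ?addr0 1?mulrC //; last first.
  by rewrite Pdiv.Ring.ltn_rmodp monic_neq0.
have -> : Pdiv.Ring.rmodp g f = g + (- Pdiv.Ring.rdivp g f) * f.
  by rewrite {2}gE mulNr addrC addKr.
by apply: ID; [apply: IB|apply: IM].
Qed.

Lemma normal_in_proper_ideal : poisson_gr_simple br G ->
  I <> [set 0] -> I <> setT ->
  exists f, [/\ homogeneous BG f, poisson_normal brB f & monic_form f].
Proof.
move=> sP In0 InT; have [[I0 ID IM] IB] := pI.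
have [f If fn0] : exists2 f : {poly P}, I f & f != 0.
  apply: contrapT => nex; apply: In0; apply/seteqP; split=> [f If|_ -> //].
  by apply: contrapT => fn0; apply: nex; exists f => //; apply/eqP.
pose Q n := `[< exists g : {poly P}, [/\ I g, g != 0 & size g = n.+1] >].
have exQ : exists n, Q n.
  exists (size f).-1; apply/asboolP; exists f; split=> //.
  by rewrite prednK // size_poly_gt0.
case: (ex_minnP exQ) => n /asboolP [g [Ig gn0 sg]] nmin.
have Imin h : I h -> (size h < n.+1)%N -> h = 0.
  move=> Ih sh; apply/eqP; apply: contraT => hn0.
  have : Q (size h).-1.
    by apply/asboolP; exists h; rewrite prednK // size_poly_gt0.
  by move/nmin; rewrite -ltnS prednK ?size_poly_gt0 // leqNgt sh.
have JT : leading_coefs n = setT.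
  case: (sP _ (leading_coefs_poisson n) (leading_coefs_graded n)) => // J0.
  have : leading_coefs n g`_n by exists g; rewrite sg.
  rewrite J0 => /= gn; move: gn0; rewrite -lead_coef_eq0 /lead_coef sg /= gn.
  by rewrite eqxx.
have : leading_coefs n 1 by rewrite JT.
move=> [h [Ih sh h1]].
(* 1 has degree 0 in P, so the component of degree n gamma keeps the leading
   coefficient. *)
pose p : {poly P} := component BG (h : kpoly P) (gamma *+ n).
have Ip : I p := graded_ideal_component HBG _ gI Ih.
have pn : p`_n = 1.
  by rewrite component_coef subrr h1; exact: (component_id HG (grading1 HG)).
have sp : size p = n.+1.
  apply/eqP; rewrite eqn_leq; apply/andP; split.
    apply/leq_sizeP => i ni; rewrite component_coef nth_default ?(leq_trans sh) //.
    exact: (component0 HG).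
  rewrite ltnNge; apply/negP => /leq_sizeP /(_ n (leqnn n)) /eqP.
  by rewrite pn oner_eq0.
have pm : p \is monic by rewrite monicE /lead_coef sp pn.
exists p; split.
- by exists (gamma *+ n); apply: (component_in HBG).
- by apply: normal_of_minimal_degree => // q Iq; rewrite sp; apply: Imin.
apply/monic_formP; split=> //; rewrite sp ltnS lt0n; apply/eqP => n0.
(* A monic element of degree 0 is 1, which a proper ideal does not contain. *)
apply: InT; apply: ideal_setT => //.
suff <- : p = 1 by [].
by rewrite (size1_polyC (_ : size p <= 1)%N) ?sp ?n0 // -[in p`_0]n0 pn.
Qed.

End MinimalDegree.

(** For a of degree tau, the map v |-> {v, a} - v alpha(a) raises degrees by tau,
    so the component of degree gamma + tau of delta(a), which is delta(a)
    itself, comes from the component of u of degree gamma. *)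
Lemma inner_homogeneous u : delta =1 inner_skew_derivation br alpha u ->
  delta =1 inner_skew_derivation br alpha (component G u gamma).
Proof.
move=> dE.
have hom tau a : G tau a ->
    delta a = inner_skew_derivation br alpha (component G u gamma) a.
  move=> Ga.
  have mD : {morph (inner_skew_derivation br alpha)^~ a : x y / x + y}.
    move=> x y; rewrite /inner_skew_derivation mulrDl.
    by rewrite (derD (poisson_derivationl Hbr a)); ring.
  have mG rho v : G rho v -> G (rho + tau) (inner_skew_derivation br alpha v a).
    move=> Gv; apply: (gradingB HG); first exact: (grading_br HG).
    by apply: (gradingM HG) => //; apply: Hcomp.1.
  have := component_eq HG (decomposition_graded_map mD mG (componentP HG u)).
  move/(congr1 (@^~ (gamma + tau))); rewrite addrK -dE => <-.
  by rewrite (component_id HG) //; apply: Hcomp.2.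
move=> a; have [s ->] := sum_components HG a.
have iD : {morph inner_skew_derivation br alpha (component G u gamma) : x y / x + y}.
  move=> x y; rewrite /inner_skew_derivation (derD Halpha.1).
  by rewrite (derD (poisson_derivationr Hbr _)); ring.
have i0 : inner_skew_derivation br alpha (component G u gamma) 0 = 0.
  by apply: (addIr (inner_skew_derivation br alpha (component G u gamma) 0));
     rewrite -iD !add0r.
rewrite (big_morph _ (derD Hdelta.1) (der0 Hdelta.1)) (big_morph _ iD i0).
by apply: eq_bigr => tau _; apply: (hom tau); apply: component_in HG _ _.
Qed.

Lemma homogeneous_normal_of_inner : skew_inner br alpha delta ->
  exists f, [/\ homogeneous BG f, poisson_normal brB f & monic_form f].
Proof.
move=> [u /inner_homogeneous dE]; set v := component G u gamma in dE.
exists ('X - v%:P ); split.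
- exists gamma; apply: poly_gradingB; first exact: poly_gradingX.
  by apply/poly_gradingC; apply: component_in HG _ _.
- exact: (normal_of_inner Hbr HB dE).
by apply/monic_formP; rewrite monicXsubC size_XsubC.
Qed.

Lemma poly_simpleP : poisson_gr_simple br G ->
  (poisson_gr_simple brB BG <->
   ~ exists f, [/\ homogeneous BG f, poisson_normal brB f & monic_form f]).
Proof.
move=> sP; split=> [sB [f [hf nf mf]]|nex I pI gI].
  exact: not_simple_of_normal hf nf mf sB.
have [->|In0] := pselect (I = [set 0]%classic); first by left.
right; apply: contrapT => InT; apply: nex.
exact: normal_in_proper_ideal pI gI sP In0 InT.
Qed.

End Compatible.
End GradedPolynomials.

(** * Gradings and graded simplicity *)

Theorem theorem4 (k : fieldType) (Gamma : zmodType) (P : comAlgType k)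
    (brP : P -> P -> P) (PG : Gamma -> set P) (alpha delta : P -> P)
    (brB : kpoly P -> kpoly P -> kpoly P) (gamma : Gamma)
    (HP : poisson_bracket brP)
    (HPG : poisson_grading brP PG)
    (Halpha : poisson_derivation brP alpha)
    (Hdelta : poisson_skew_derivation brP alpha delta)
    (HB : poisson_poly_bracket brP alpha delta brB) :
  [/\ (exists BG : Gamma -> set (kpoly P),
         [/\ poisson_grading brB BG,
             forall tau a, BG tau a%:P <-> PG tau a
           & BG gamma 'X])
        <-> compatible PG gamma alpha delta,
      compatible PG gamma alpha delta -> poisson_gr_simple brP PG ->
        (poisson_gr_simple brB (poly_grading PG gamma) <->
         ~ exists f : kpoly P,
             [/\ homogeneous (poly_grading PG gamma) f,
                 poisson_normal brB f & monic_form f])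
    & compatible PG gamma alpha delta -> poisson_gr_simple brP PG ->
        [pchar k] =i pred0 ->
        (poisson_gr_simple brB (poly_grading PG gamma) <->
         ~ skew_inner brP alpha delta)].
Proof.
split.
- split=> [[BG [HBG BGC BGX]]|Hcomp]; first exact: (compatible_of_grading HPG HB HBG BGC BGX).
  exists (poly_grading PG gamma); split.
  + exact: (poly_grading_poisson HP HPG Halpha Hdelta HB Hcomp).
  + by move=> tau a; apply: (poly_gradingC _ HPG).
  + exact: (poly_gradingX _ HPG).
- by move=> Hcomp sP; exact: (poly_simpleP HP HPG Halpha Hdelta HB Hcomp sP).
- move=> Hcomp sP chk.
  have [sB_normal normal_sB] := poly_simpleP HP HPG Halpha Hdelta HB Hcomp sP.
  split=> [/sB_normal nex inn|ninn].
    by apply: nex; exact: (homogeneous_normal_of_inner HP HPG Halpha Hdelta HB Hcomp inn).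
  apply: normal_sB => -[f [_ nf mf]]; apply: ninn.
  exact: (inner_of_normal HP Halpha Hdelta HB chk nf mf).
Qed.
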